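(* Let $G$ be a signed graph (regarded, via an orientation, as a bidirected graph) with Laplacian matrix $\mathbf{L}_G$. Let $\mathfrak{M}^{-}$ be the set of maximal elements (with respect to $\leq_a$) of the positive-circle-free activation classes of $G$, i.e. of those activation classes none of whose members contains a positive circle. Then $$\det(\mathbf{L}_G)=\sum_{c\in\mathfrak{M}^{-}}2^{nc(c)},$$ where $nc(c)$ is the number of negative circles in $c$ (an empty sum being $0$).
   Context: A bidirected graph is a quintuple $G=(V,E,I,\iota,\sigma)$ where $V,E,I$ are disjoint finite sets (vertices, edges, incidences), $\iota:I\to V\times E$ and $\sigma:I\to\{+1,-1\}$ are functions, and every edge belongs to exactly two incidences. It is an orientation of the signed graph in which an edge $e$ with incidences $i,j$ has sign $sgn(e)=-\sigma(i)\sigma(j)$. Parallel edges and loops are allowed. Let $\overrightarrow{P}_1$ be the directed path of length 1. An incidence preserving map $\overrightarrow{P}_1\to G$ is the same as a sequence $(v,i,e,j,w)$ with $\iota(i)=(v,e)$, $\iota(j)=(w,e)$ (tail sent to $v$, head sent to $w$). It is a backstep if $i=j$, and a directed adjacency if $i\ne j$ (a loop if also $v=w$). The sign of a weak walk of length $k$ (a concatenation of $k$ such sequences) with incidence sequence $i_1,\dots,i_{2k}$ is $(-1)^k\prod_{h=1}^{2k}\sigma(i_h)$. The Laplacian $\mathbf{L}_G$ is the $V\times V$ matrix whose $(v,w)$-entry is $\sum_\omega -sgn(\omega)$ over all incidence preserving maps $\omega:\overrightarrow{P}_1\to G$ with tail sent to $v$ and head sent to $w$. A pre-contributor of $G$ is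 an incidence preserving map $p:\coprod_{v\in V}\overrightarrow{P}_1\to G$ (one copy $(\overrightarrow{P}_1)_v$ with tail $t_v$, head $h_v$ for each $v\in V$) with $p(t_v)=v$ for all $v$. A contributor is a pre-contributor with $\{p(h_v)\mid v\in V\}=V$; $\mathfrak{C}(G)$ is the set of contributors. Unpacking a pre-contributor at a vertex $v$ where $p((\overrightarrow{P}_1)_v)=(v,i,e,i,v)$ is a backstep means replacing this value by $(v,i,e,j,w)$, where $j\neq i$ is the other incidence of $e$ and $\iota(j)=(w,e)$, leaving all other values unchanged. For a contributor $c$, the permutation $v\mapsto c(h_v)$ decomposes its image into cycles; the circles of $c$ are those cycles which are not single backsteps (loops and closed weak walks of length 2 formed by two directed adjacencies count as circles). $tc(c)$ is the number of circles of $c$; a circle is positive or negative according to its sign as a weak walk. Activating a circle of $c$ is a minimal sequence of unpackings resulting in a contributor $c'$ with $tc(c')=tc(c)+1$. The activation partial order is: $c\leq_a d$ if $d$ is obtained from $c$ by a (possibly empty) sequence of activations. $\sim_a$ is the equivalence relation on $\mathfrak{C}(G)$ generated by comparability under $\leq_a$, and its classes are the activation classes of $G$. Each activation class, ordered by $\leq_a$, is a boolean lattice, so it has a unique maximal element. *)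

(* Defs.v *)
From HB Require Import structures.
From mathcomp Require Import all_boot all_order all_fingroup all_algebra.
From mathcomp Require Import boolp.

Set Implicit Arguments.
Unset Strict Implicit.
Unset Printing Implicit Defensive.

Import GRing.Theory Num.Theory.
Local Open Scope ring_scope.

Record bidirected_graph := BidirectedGraph {
  vertex : finType;
  edge : finType;
  incidence : finType;
  inc : incidence -> vertex * edge;
  isgn : incidence -> int;
  isgnP : forall i, isgn i \in [:: 1; -1];
  edgeP : forall e : edge, #|[set i | (inc i).2 == e]| = 2
}.

(* An incidence preserving map P_1 -> G, that is a sequence (v,i,e,j,w) with
   inc i = (v,e) and inc j = (w,e).  It is stored as the pair (i,j), which
   determines v, e and w; the condition is that i and j have the same edge. *)
Record ipmap (G : bidirected_graph) := IPMap {
  ipmap_pair : incidence G * incidence G;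
  _ : (inc ipmap_pair.1).2 == (inc ipmap_pair.2).2
}.
HB.instance Definition _ G := [isSub for @ipmap_pair G].
HB.instance Definition _ G := [Finite of ipmap G by <:].

Section IncidencePreservingMaps.
Variable G : bidirected_graph.
Implicit Types x : ipmap G.

Definition tail_inc x : incidence G := (val x).1.
Definition head_inc x : incidence G := (val x).2.
Definition tail x : vertex G := (inc (tail_inc x)).1.
Definition head x : vertex G := (inc (head_inc x)).1.

Definition backstep x : bool := tail_inc x == head_inc x.

Definition walk_sign (s : seq (ipmap G)) : int :=
  (-1) ^+ size s * \prod_(x <- s) (isgn (tail_inc x) * isgn (head_inc x)).

(* Rows and columns are numbered by the enumeration of the vertices. *)
Definition laplacian : 'M[int]_#|vertex G| :=
  \matrix_(a, b) \sum_(x : ipmap G | (tail x == enum_val a)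
                                   && (head x == enum_val b))
                    - walk_sign [:: x].

End IncidencePreservingMaps.

Record precontributor (G : bidirected_graph) := PreContributor {
  precontributor_fun : {ffun vertex G -> ipmap G};
  _ : [forall v, tail (precontributor_fun v) == v]
}.
HB.instance Definition _ G := [isSub for @precontributor_fun G].
HB.instance Definition _ G := [Finite of precontributor G by <:].

Definition fun_of_precontributor G (p : precontributor G) :
  vertex G -> ipmap G := precontributor_fun p.
Coercion fun_of_precontributor : precontributor >-> Funclass.

Record contributor (G : bidirected_graph) := Contributor {
  contributor_val :> precontributor G;
  _ : [set head (contributor_val v) | v : vertex G] == [set: vertex G]
}.
HB.instance Definition _ G := [isSub for @contributor_val G].
HB.instance Definition _ G := [Finite of contributor G by <:].

Section Contributors.
Variable G : bidirected_graph.
Implicit Types (p q r : precontributor G) (c d : contributor G).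

(* q v is an incidence preserving map, so its head incidence lies on the same
   edge as its tail incidence and is the other incidence of that edge. *)
Definition unpack_at (v : vertex G) p q : bool :=
  [&& backstep (p v),
      tail_inc (q v) == tail_inc (p v),
      head_inc (q v) != head_inc (p v)
    & [forall u, (u != v) ==> (q u == p u)]].

(* s lists the vertices at which the successive unpackings take place. *)
Fixpoint unpack_seq (s : seq (vertex G)) p q : bool :=
  if s is v :: s' then [exists r, unpack_at v p r && unpack_seq s' r q]
  else p == q.

Lemma head_contributor_inj c : injective (fun v => head (c v)).
Proof.
case: c => p /= /eqP pT v w.
have/imset_injP inj_p : #|[set head (p u) | u : vertex G]| == #|vertex G|.
  by rewrite pT cardsT.
exact: inj_p.
Qed.

Definition contributor_perm c : {perm vertex G} :=
  perm (@head_contributor_inj c).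

(* A circle is given by its set of vertices, an orbit of the permutation. *)
Definition circles c : {set {set vertex G}} :=
  [set O in porbits (contributor_perm c)
     | ~~ [exists v, (O == [set v]) && backstep (c v)]].

Definition tc c : nat := #|circles c|.

(* The sign does not depend on the order in which the steps are listed. *)
Definition circle_sign c (O : {set vertex G}) : int :=
  walk_sign [seq c v | v <- enum O].

Definition positive_circles c := [set O in circles c | circle_sign c O == 1].
Definition negative_circles c := [set O in circles c | circle_sign c O == -1].

Definition nc c : nat := #|negative_circles c|.

Definition creates_circle (s : seq (vertex G)) c d : bool :=
  unpack_seq s c d && (tc d == (tc c).+1).

(* Minimality is with respect to omitting some of the unpackings. *)
Definition activates c d : Prop :=
  exists2 s, creates_circle s c d &
    forall s' d', subseq s' s -> creates_circle s' c d' -> s' = s.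

Definition act_le : rel (contributor G) :=
  connect (fun c d => `[< activates c d >]).

Definition act_equiv : rel (contributor G) :=
  connect (fun c d => act_le c d || act_le d c).

Definition activation_classes : {set {set contributor G}} :=
  equivalence_partition act_equiv [set: contributor G].

Definition positive_circle_free (A : {set contributor G}) : bool :=
  [forall c in A, positive_circles c == set0].

Definition maximal_in (A : {set contributor G}) c : bool :=
  (c \in A) && [forall d in A, act_le c d ==> (d == c)].

Definition maximal_positive_circle_free : {set contributor G} :=
  [set c | [exists A in activation_classes,
              positive_circle_free A && maximal_in A c]].

End Contributors.

(* Main.v *)
(* A contributor is determined by its tail incidences t and by its set B of
   vertices that are not backsteps.  Sending v to the other end of the edge at
   t v defines a map on the vertices, and B is a union of cycles of that map;
   an activation adds one cycle to B.  Hence an activation class consists of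
   all contributors with a given t, its maximum m has all cycles active, and
   its members correspond to the subsets of the circles of m.  In the Leibniz
   expansion of the determinant a contributor counts for the product of
   - sgn over its circles, so a class contributes the product of 1 - sgn over
   the circles of m, which is 0 if one is positive and 2 ^ nc m otherwise. *)

Require Import Defs.
From mathcomp Require Import all_boot all_order all_fingroup all_algebra.
From mathcomp Require Import boolp.
Import Defs.

Import GRing.Theory Num.Theory.
Local Open Scope ring_scope.

(** * Permutations: stable sets, and parity under the enumeration of a finite type *)

Section Permutations.
Variable T : finType.

(** By injectivity and finiteness [s] maps [D] onto [D], so no point outside can enter it. *)
Lemma mem_perm_stable (s : {perm T}) (D : {set T}) w :
  {in D, forall v, s v \in D} -> (s w \in D) = (w \in D).
Proof.
move=> sD; have {1}<- : s @: D = D; last exact/mem_imset/perm_inj.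
apply/eqP; rewrite eqEcard card_imset ?leqnn ?andbT; last exact: perm_inj.
by apply/subsetP => _ /imsetP[v vD ->]; apply: sD.
Qed.

(** Parity is read off from the number of orbits, and [enum_rank] carries the orbits of [s]
    bijectively to those of [s']. *)
Lemma odd_perm_enum (s : {perm T}) (s' : 'S_#|T|) :
  (forall v, s' (enum_rank v) = enum_rank (s v)) -> odd_perm s' = odd_perm s.
Proof.
move=> E; rewrite /odd_perm card_ord; congr (_ (+) odd _).
have En n v : (s' ^+ n)%g (enum_rank v) = enum_rank ((s ^+ n)%g v).
  by elim: n => [|n IH]; rewrite ?expg0 ?perm1 // !expgSr !permM IH E.
have Ep v : porbit s' (enum_rank v) = enum_rank @: porbit s v.
  apply/setP => i; apply/porbitP/imsetP => [[n ->]|[w /porbitP[n ->] ->]].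
    by exists ((s ^+ n)%g v); rewrite ?mem_porbit.
  by exists n.
rewrite -(card_imset _ (imset_inj (@enum_rank_inj T))).
apply: eq_card => O; apply/imsetP/imsetP => -[].
  move=> i _ ->; exists (porbit s (enum_val i)); first exact: imset_f.
  by rewrite -Ep enum_valK.
by move=> _ /imsetP[v _ ->] ->; exists (enum_rank v); rewrite ?Ep.
Qed.

(** Bridges permutations of the vertices and the permutations of ordinals over which [\det] is
    expanded. *)
Definition perm_enum (s : {perm T}) : 'S_#|T| :=
  perm (inj_comp (@enum_rank_inj T)
    (inj_comp (@perm_inj _ s) (@enum_val_inj _ (T)))).

Lemma perm_enumE s v : perm_enum s (enum_rank v) = enum_rank (s v).
Proof. by rewrite permE /= enum_rankK. Qed.

Lemma perm_enum_bij : bijective perm_enum.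
Proof.
apply: inj_card_bij.
  move=> s t E; apply/permP => v; apply: enum_rank_inj.
  by rewrite -!perm_enumE E.
have card_S (U : finType) : #|{: {perm U}}| = (#|U|)`!.
  rewrite -[#|U|]cardsT -card_perm; apply: eq_card => s.
  by apply/esym/subsetP => v _; rewrite inE.
by rewrite !card_S card_ord.
Qed.

End Permutations.

(** * Contributors encoded by tail incidences and active vertices *)

Section Contributors.
Variable G : bidirected_graph.
Implicit Types (x y : ipmap G) (p q : precontributor G) (c d m : contributor G).
Implicit Types (u v w : vertex G) (D O : {set vertex G}).

(** An edge has two incidences, so a tail incidence only leaves the choice between staying and
    crossing. *)
Lemma ipmap_eq x y :
  tail_inc x = tail_inc y -> backstep x = backstep y -> x = y.
Proof.
move=> txy bxy; apply: val_inj.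
have hxy : head_inc x = head_inc y.
  have [bx|nbx] := boolP (backstep x).
    by move: bx (bx); rewrite {2}bxy => /eqP <- /eqP <-.
  apply/eqP/negPn/negP => nh.
  have nby : ~~ backstep y by rewrite -bxy.
  (* Otherwise one edge would carry three distinct incidences. *)
  have := edgeP (inc (tail_inc x)).2.
  have sub : [set tail_inc x; head_inc x; head_inc y]
      \subset [set i | (inc i).2 == (inc (tail_inc x)).2].
    apply/subsetP => i; rewrite !inE => /orP[/orP[]|] /eqP->//.
      by have := valP x; rewrite eq_sym.
    by have := valP y; rewrite txy eq_sym.
  move=> card2; have := subset_leq_card sub.
  rewrite card2 -setUA cardsU1 cards2 !inE nh.
  by move: nbx nby; rewrite /backstep -txy => /negPf-> /negPf->.
by rewrite [LHS]surjective_pairing [RHS]surjective_pairing; congr pair.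
Qed.

Lemma tail_contributor c v : tail (c v) = v.
Proof. by apply/eqP; move/forallP: (valP (contributor_val c)); apply. Qed.

Lemma backstep_head x : backstep x -> head x = tail x.
Proof. by rewrite /backstep /head /tail => /eqP->. Qed.

Lemma contributor_permE c v : contributor_perm c v = head (c v).
Proof. by rewrite permE. Qed.

Lemma ex_contributor (f : vertex G -> ipmap G) :
    (forall v, tail (f v) = v) -> injective (fun v => head (f v)) ->
  exists c, forall v, c v = f v.
Proof.
move=> tf hf.
have tP : [forall v, tail ([ffun v => f v] v) == v].
  by apply/forallP => v; rewrite ffunE tf.
have sP : [set head (PreContributor tP v) | v : vertex G]
            == [set: vertex G].
  rewrite eqEcard subsetT cardsT card_imset //= => u v.
  by rewrite /fun_of_precontributor /= !ffunE => /hf.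
by exists (Contributor sP) => v; rewrite /fun_of_precontributor /= ffunE.
Qed.

(** Unpacking never changes this function; it will label the activation classes. *)
Definition tails p := [ffun v => tail_inc (p v)].

Definition active p : {set vertex G} := [set v | ~~ backstep (p v)].

Lemma precontributor_eq p q : tails p = tails q -> active p = active q -> p = q.
Proof.
move=> tpq apq; apply/val_inj/ffunP => v; apply: ipmap_eq.
  by move/ffunP/(_ v): tpq; rewrite !ffunE.
by move/setP/(_ v): apq; rewrite !inE => /negb_inj.
Qed.

Lemma contributor_eq c d : tails c = tails d -> active c = active d -> c = d.
Proof. by move=> tcd acd; apply/val_inj/precontributor_eq. Qed.

Lemma eq_on_active p q v :
  tails p = tails q -> v \in active p -> v \in active q -> p v = q v.
Proof.
rewrite !inE => /ffunP/(_ v); rewrite !ffunE => t ap aq; apply: ipmap_eq => //.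
by rewrite (negPf ap) (negPf aq).
Qed.

Lemma head_inactive c v : v \notin active c -> head (c v) = v.
Proof. by rewrite inE negbK => /backstep_head->; rewrite tail_contributor. Qed.

(** An inactive head would be its own image as well as that of [v], hence equal to [v] by
    injectivity. *)
Lemma head_active c v : v \in active c -> head (c v) \in active c.
Proof.
move=> av; apply: contraLR (av) => nah.
have /head_contributor_inj <- : head (c (head (c v))) = head (c v).
  exact: head_inactive.
by [].
Qed.

(** Either [v] is active in [d] too and both maps agree there, or [d] fixes [v]. *)
Lemma head_active_stable c d v : tails c = tails d ->
  v \in active c -> head (d v) \in active c.
Proof.
move=> tcd ac; have [ad|nad] := boolP (v \in active d).
  by rewrite -(eq_on_active _ _ _ tcd ac ad) head_active.
by rewrite head_inactive.
Qed.

(** * Restriction, join and greatest element for given tails *)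

(** Backsteps outside [D] fix their vertices and [d] maps [D] into itself, so heads stay
    distinct. *)
Lemma ex_restriction d D : {in D, forall v, head (d v) \in D} ->
  exists c, tails c = tails d /\ active c = active d :&: D.
Proof.
move=> sD.
pose bs v := @IPMap G (tail_inc (d v), tail_inc (d v)) (eqxx _).
have tbs v : tail (bs v) = v by exact: tail_contributor.
have [||c cE] := ex_contributor (fun v => if v \in D then d v else bs v).
- by move=> v; case: ifP => _; rewrite ?tail_contributor.
- move=> v w /=; case: ifP => vD; case: ifP => wD.
  + exact: head_contributor_inj.
  + by rewrite [X in _ = X]tbs => E; rewrite -E sD in wD.
  + by rewrite [X in X = _]tbs => E; rewrite E sD in vD.
  + by rewrite [LHS]tbs [RHS]tbs.
exists c; split.
  by apply/ffunP => v; rewrite !ffunE cE; case: ifP.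
apply/setP => v; rewrite !inE cE; case: ifP => _; rewrite ?andbT ?andbF //.
by rewrite /backstep eqxx.
Qed.

(* [c] and [d] agree where both are active, so [active c] is invariant under [d]
   and the contributor that follows [c] on [active c] and [d] elsewhere exists. *)
Lemma ex_join c d : tails c = tails d ->
  exists c', tails c' = tails d /\ active c' = active c :|: active d.
Proof.
move=> tcd.
have st w : (head (d w) \in active c) = (w \in active c).
  rewrite -contributor_permE mem_perm_stable // => v vc.
  by rewrite contributor_permE head_active_stable.
have [||c' cE] := ex_contributor (fun v => if v \in active c then c v else d v).
- by move=> v; case: ifP => _; rewrite ?tail_contributor.
- move=> v w /=; case: ifP => va; case: ifP => wa.
  + exact: head_contributor_inj.
  + by move=> E; rewrite -st -E head_active in wa.
  + by move=> E; rewrite -st E head_active in va.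
  + exact: head_contributor_inj.
exists c'; split.
  move/ffunP: tcd => tcd; apply/ffunP => v; move: (tcd v).
  by rewrite !ffunE cE; case: ifP.
by apply/setP => v; rewrite !inE cE inE; case: ifP => //= ->.
Qed.

(** Take [m] with the most active vertices: its join with any [d] cannot be larger. *)
Lemma ex_top c : exists m, tails m = tails c /\
  forall d, tails d = tails c -> active d \subset active m.
Proof.
pose P := [pred d : contributor G | tails d == tails c].
have Pc : P c by rewrite /= eqxx.
have [m] := arg_maxnP (fun d : contributor G => #|active d|) Pc.
move=> /= /eqP tm mmax.
exists m; split=> // d td.
have [c' [tc' ac']] : exists c', tails c' = tails m /\
    active c' = active d :|: active m by apply: ex_join; rewrite td.
have /mmax : tails c' == tails c by rewrite tc' tm.
rewrite ac' => le.
have /eqP-> : active m == active d :|: active m by rewrite eqEcard subsetUr.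
exact: subsetUl.
Qed.

(** * Circles as orbits of active vertices *)

Lemma porbit_inactive c v : v \notin active c ->
  porbit (contributor_perm c) v = [set v].
Proof.
move=> nav; apply/setP => w; rewrite inE; apply/porbitP/eqP => [[n ->]|->].
  by elim: n => [|n IH]; rewrite ?expg0 ?perm1 // expgSr permM IH
    contributor_permE head_inactive.
by exists 0%N; rewrite expg0 perm1.
Qed.

Lemma circlesE c : circles c = porbit (contributor_perm c) @: active c.
Proof.
apply/setP => O; rewrite inE; apply/andP/imsetP => [[/imsetP[v _ ->]]|].
  move=> nb; exists v => //; apply: contraR nb => nav.
  apply/existsP; exists v; rewrite porbit_inactive // eqxx.
  by rewrite inE negbK in nav.
move=> [v va ->]; split; first exact: imset_f.
apply/negP => /existsP[w /andP[/eqP vw]].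
have := porbit_id (contributor_perm c) v; rewrite vw inE => /eqP <-.
by move: va; rewrite inE => /negPf->.
Qed.

(** The orbit under [c] never leaves [active c], where [c] and [d] agree. *)
Lemma porbit_active c d v : tails c = tails d -> active c \subset active d ->
  v \in active c ->
  porbit (contributor_perm c) v = porbit (contributor_perm d) v.
Proof.
move=> tcd /subsetP acd va.
have E n : (contributor_perm c ^+ n)%g v = (contributor_perm d ^+ n)%g v
    /\ (contributor_perm c ^+ n)%g v \in active c.
  elim: n => [|n [IH IHa]]; first by rewrite !expg0 perm1.
  rewrite !expgSr !permM -IH !contributor_permE; split; last exact: head_active.
  by rewrite (eq_on_active _ _ _ tcd) ?acd.
apply/setP => w; apply/porbitP/porbitP => -[n ->]; exists n;
  by case: (E n) => ->.
Qed.

Lemma circlesE_below c d : tails c = tails d -> active c \subset active d ->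
  circles c = porbit (contributor_perm d) @: active c.
Proof.
by move=> tcd acd; rewrite circlesE; apply: eq_in_imset => v; apply: porbit_active.
Qed.

Lemma circles_subset c d : tails c = tails d -> active c \subset active d ->
  circles c \subset circles d.
Proof.
by move=> tcd acd; rewrite (circlesE_below c d) // circlesE imsetS.
Qed.

Lemma circle_porbit c O v : O \in circles c -> v \in O ->
  O = porbit (contributor_perm c) v.
Proof.
by rewrite circlesE => /imsetP[u ua ->]; rewrite -eq_porbit_mem eq_sym => /eqP.
Qed.

Lemma head_circle c O v : O \in circles c -> (head (c v) \in O) = (v \in O).
Proof.
move=> OC; rewrite -contributor_permE; apply: mem_perm_stable => u uO.
by rewrite (circle_porbit _ _ _ OC uO) (mem_porbit _ 1).
Qed.

Lemma circle_active c O : O \in circles c -> O \subset active c.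
Proof.
rewrite circlesE => /imsetP[v va ->]; apply/subsetP => w /porbitP[n ->].
elim: n => [|n IH]; first by rewrite expg0 perm1.
by rewrite expgSr permM contributor_permE head_active.
Qed.

Lemma cover_circles c : cover (circles c) = active c.
Proof.
apply/eqP; rewrite eqEsubset; apply/andP; split.
  by apply/bigcupsP => O; apply: circle_active.
apply/subsetP => v va; apply/bigcupP.
exists (porbit (contributor_perm c) v); last exact: porbit_id.
by rewrite circlesE imset_f.
Qed.

Lemma tails_circles_inj c d : tails c = tails d -> circles c = circles d -> c = d.
Proof. by move=> t e; apply: contributor_eq; rewrite // -!cover_circles e. Qed.

(** The union of the circles in [S] is stable under [m], so [m] can be restricted to it. *)
Lemma ex_subcircles m (S : {set {set vertex G}}) : S \subset circles m ->
  exists c, [/\ tails c = tails m, active c \subset active m & circles c = S].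
Proof.
move=> /subsetP sS; have [v /bigcupP[O OS vO]|c [tcm]] := ex_restriction m (cover S).
  by apply/bigcupP; exists O => //; rewrite head_circle ?sS.
have cS : cover S \subset active m.
  by apply/bigcupsP => O /sS; apply: circle_active.
rewrite (setIidPr cS) => ac; exists c; rewrite ac; split=> //.
rewrite (circlesE_below c m) ?ac //; apply/setP => O.
apply/imsetP/idP => [[v /bigcupP[O' O'S vO'] ->]|OS].
  by rewrite -(circle_porbit m O') ?sS.
have := sS _ OS; rewrite circlesE => /imsetP[v _ OE]; exists v => //.
by apply/bigcupP; exists O => //; rewrite OE porbit_id.
Qed.


(** * Unpacking, activation and the activation order *)

Lemma unpack_atE v p q : unpack_at v p q ->
  tails q = tails p /\ active q = v |: active p.
Proof.
move=> /and4P[bp /eqP tpq hpq /forallP upq]; split.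
  apply/ffunP => u; rewrite !ffunE; have := upq u.
  by case: eqP => [->|_ /eqP->].
apply/setP => u; rewrite !inE; have := upq u.
case: eqP => [->|_ /eqP->] //= _.
by rewrite /backstep tpq (eqP bp) eq_sym.
Qed.

Lemma unpack_seqE s p q : unpack_seq s p q ->
  tails q = tails p /\ active q = [set v in s] :|: active p.
Proof.
elim: s p => [|v s IH] p /=.
  by move/eqP->; split=> //; apply/setP => v; rewrite !inE.
move=> /existsP[r /andP[/unpack_atE[tr ar] /IH[tq aq]]].
rewrite tq tr aq ar; split=> //.
by apply/setP => u; rewrite !inE; case: (u == v); rewrite ?orbT.
Qed.

(** Converse of [unpack_seqE]: distinct inactive vertices can be unpacked one at a time, through
    pre-contributors. *)
Lemma unpack_seq_ex s p q : uniq s -> tails q = tails p ->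
  active q = [set v in s] :|: active p -> {in s, forall v, v \notin active p} ->
  unpack_seq s p q.
Proof.
elim: s p => [|v s IH] p /=.
  move=> _ t a _; apply/eqP/precontributor_eq => //.
  by rewrite a; apply/setP => v; rewrite !inE.
move=> /andP[vs us] t a ns.
(* The first unpacking gives [v] its final value. *)
pose f := [ffun u => if u == v then q v else p u].
have tf : [forall u, tail (f u) == u].
  apply/forallP => u; rewrite ffunE.
  by case: (u =P v) => [->|_]; [move/forallP: (valP q)|move/forallP: (valP p)]; apply.
pose r := PreContributor tf.
have rE u : r u = if u == v then q v else p u.
  by rewrite /fun_of_precontributor /= ffunE.
have pv : backstep (p v) by have := ns v; rewrite !inE eqxx negbK; exact.
have tv : tail_inc (q v) = tail_inc (p v).
  by move/ffunP/(_ v): t; rewrite !ffunE.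
have qv : ~~ backstep (q v).
  by move/setP/(_ v): a; rewrite !inE eqxx.
have uvr : unpack_at v p r.
  apply/and4P; split; rewrite // ?rE ?eqxx ?tv //.
    by rewrite -(eqP pv) -tv eq_sym.
  by apply/forallP => u; apply/implyP => uv; rewrite rE (negPf uv).
apply/existsP; exists r; rewrite uvr /=.
have [tr ar] := unpack_atE _ _ _ uvr.
apply: IH; rewrite ?tr // ?ar.
  by rewrite a; apply/setP => u; rewrite !inE; case: (u == v); rewrite ?orbT.
move=> u us'; rewrite in_setU1 negb_or ns ?inE ?us' ?orbT // andbT.
by apply: contraNneq vs => <-.
Qed.

Lemma activatesE c d : activates c d ->
  tails d = tails c /\ active c \subset active d.
Proof.
by move=> [s /andP[/unpack_seqE[t a] _] _]; split; rewrite // a subsetUr.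
Qed.

(** Making [O] inactive leaves every other circle of [d] intact, so exactly [O] is lost. *)
Lemma tc_deactivated c d O : O \in circles d -> tails c = tails d ->
  active c = active d :\: O -> tc d = (tc c).+1.
Proof.
move=> OC t a; rewrite /tc (cardsD1 O) OC add1n; congr _.+1.
apply: eq_card => O'; rewrite (circlesE_below c d) ?a ?subsetDl // circlesE.
apply/idP/imsetP => [|[v]].
  rewrite !inE => /andP[nO /imsetP[v va O'E]]; exists v => //.
  rewrite inE va andbT; apply: contraNN nO => vO.
  by rewrite O'E -(circle_porbit _ _ _ OC vO).
rewrite inE => /andP[vO va] ->; rewrite inE imset_f // andbT.
by apply: contraNN vO => /set1P <-; apply: porbit_id.
Qed.

(** A circle of [d] is active in [c] either entirely or not at all, since orbits through [active c]
    coincide. *)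
Lemma circle_subset_active c d O v : tails c = tails d ->
  active c \subset active d -> O \in circles d -> v \in O -> v \in active c ->
  O \subset active c.
Proof.
move=> t a OC vO vc; rewrite (circle_porbit _ _ _ OC vO) -(porbit_active c) //.
by apply: circle_active; rewrite circlesE imset_f.
Qed.

Lemma activates_deactivated c d O : O \in circles d -> tails c = tails d ->
  active c = active d :\: O -> activates c d.
Proof.
move=> OC t a; have Oa := circle_active _ _ OC; exists (enum O).
  rewrite /creates_circle (tc_deactivated c d O) // eqxx andbT.
  apply: unpack_seq_ex; rewrite ?enum_uniq //.
    rewrite a; apply/setP => v; rewrite !inE mem_enum.
    by have /subsetP/(_ v) := Oa; rewrite inE; case: (v \in O) => //= ->.
  by move=> v; rewrite mem_enum a !inE => ->.
move=> s d' sub /andP[/unpack_seqE[t' a'] /eqP tcd'].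
have sO : {subset s <= O} by move=> v /(mem_subseq sub); rewrite mem_enum.
(* The empty sequence leaves [c] unchanged and cannot raise [tc]. *)
have [v vs] : exists v, v \in s.
  case: s sub t' a' {sO} => [|v s] _ t' a'; last by exists v; rewrite mem_head.
  suff E : d' = c by move: tcd'; rewrite E => /n_Sn.
  by apply: contributor_eq => //; rewrite a'; apply/setP => v; rewrite !inE.
(* One unpacked vertex of [O] forces all of [O] to be active, so [s] cannot omit any of them. *)
have Oa' : O \subset active d'.
  apply: (circle_subset_active d' d O v) => //.
  - by rewrite t'.
  - rewrite a' a subUset subsetDl andbT; apply/subsetP => w; rewrite inE.
    by move/sO; apply: (subsetP Oa).
  - exact: sO.
  - by rewrite a' !inE vs.
apply/eqP; rewrite -(geq_leqif (size_subseq_leqif sub)).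
apply: uniq_leq_size; first exact: enum_uniq.
move=> w; rewrite mem_enum => wO; have := subsetP Oa' w wO.
by rewrite a' a !inE wO orbF.
Qed.

(** For the converse, induct on the number of vertices active only in [d]: deactivating the circle
    of [d] through one of them gives a smaller contributor still above [c]. *)
Lemma act_leP c d :
  reflect (tails c = tails d /\ active c \subset active d) (act_le c d).
Proof.
apply: (iffP idP) => [/connectP[s]|].
  elim: s c => [|c' s IH] c /=; first by move=> _ ->.
  move=> /andP[/asboolP/activatesE[<- a] /IH{}IH /IH[-> a']]; split=> //.
  exact: subset_trans a a'.
move=> [tcd]; have [n] := ubnP #|active d :\: active c|.
elim: n d tcd => // n IH d tcd; rewrite ltnS => le acd.
have [sub|/subsetPn[v vd vc]] := boolP (active d \subset active c).
  suff -> : c = d by exact: connect0.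
  by apply: contributor_eq => //; apply/eqP; rewrite eqEsubset acd.
pose O := porbit (contributor_perm d) v.
have OC : O \in circles d by rewrite circlesE imset_f.
(* If [O] met [active c] it would lie inside it, but [v] does not. *)
have disO w : w \in active c -> w \notin O.
  move=> wc; apply: contra vc => wO.
  exact: (subsetP (circle_subset_active _ _ _ _ tcd acd OC wO wc)) (porbit_id _ _).
have [u|d' [td' ad']] := ex_restriction d (~: O).
  by rewrite !in_setC head_circle.
rewrite -setDE in ad'.
apply: (@connect_trans _ _ d'); last first.
  by apply: connect1; apply/asboolP; apply: (activates_deactivated _ _ O).
apply: IH; rewrite ?td' // ad'.
  apply: leq_trans le; apply: proper_card; apply/properP; split.
    by apply: setSD; apply: subsetDl.
  by exists v; rewrite inE vc ?vd ?andbT // inE porbit_id.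
by apply/subsetP => w wc; rewrite inE disO // (subsetP acd).
Qed.

(** * Activation classes and their maximal elements *)

(** Activations preserve tails, and contributors with equal tails lie below a common top. *)
Lemma act_equivE c d : act_equiv c d = (tails c == tails d).
Proof.
apply/idP/eqP => [/connectP[s]|tcd].
  elim: s c => [|c' s IH] c /=; first by move=> _ ->.
  by move=> /andP[/orP[]/act_leP[t _] /IH{}IH /IH <-].
have [m [tm mmax]] := ex_top c.
apply: (@connect_trans _ _ m); apply: connect1; apply/orP; [left|right];
  by apply/act_leP; rewrite ?mmax // ?tm.
Qed.

Lemma activation_classP (A : {set contributor G}) :
  reflect (exists c, A = [set d : contributor G | tails c == tails d])
          (A \in activation_classes G).
Proof.
apply: (iffP imsetP) => [[c _ ->]|[c ->]]; exists c => //;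
  by apply/setP => d; rewrite !inE act_equivE.
Qed.

(** By [act_leP] and [act_equivE], this makes [m] the greatest element of its activation class, not
    merely a maximal one. *)
Definition is_top m :=
  [forall d : contributor G, (tails d == tails m) ==> (active d \subset active m)].

Lemma is_topP m :
  reflect (forall d, tails d = tails m -> active d \subset active m) (is_top m).
Proof.
apply: (iffP forallP) => [H d td|H d]; last by apply/implyP => /eqP/H.
by have := H d; rewrite td eqxx.
Qed.

Lemma circle_signE c O : circle_sign c O =
  (-1) ^+ #|O| * \prod_(v in O) (isgn (tail_inc (c v)) * isgn (head_inc (c v))).
Proof. by rewrite /circle_sign /walk_sign size_map -cardE big_map big_enum. Qed.

Lemma circle_sign_eq c d O : tails c = tails d ->
  O \subset active c -> O \subset active d -> circle_sign c O = circle_sign d O.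
Proof.
move=> t /subsetP Oc /subsetP Od; rewrite !circle_signE; congr (_ * _).
by apply: eq_bigr => v vO; rewrite (eq_on_active c d) ?Oc ?Od.
Qed.

Lemma positive_circles_below c d : tails c = tails d ->
  active c \subset active d -> positive_circles c \subset positive_circles d.
Proof.
move=> t a; apply/subsetP => O /setIdP[OC pos]; have Oc := circle_active _ _ OC.
apply/setIdP; split; first exact: (subsetP (circles_subset _ _ t a)).
by rewrite -(circle_sign_eq c d) ?(subset_trans Oc a).
Qed.

(** Each class has a greatest element, so maximal means top; the top inherits every positive circle
    of the class, so it alone needs testing. *)
Lemma maximal_positive_circle_freeE m :
  (m \in maximal_positive_circle_free G)
    = is_top m && (positive_circles m == set0).
Proof.
rewrite inE; apply/existsP/andP.
  move=> [A /and3P[/activation_classP[x ->] /forallP pcf]].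
  move=> /andP[mA /forallP mmax]; split.
    rewrite inE in mA; have [m' [tm' top]] := ex_top m.
    have := mmax m'; rewrite inE tm' mA /=.
    have -> /= : act_le m m' by apply/act_leP; rewrite tm' top.
    by move=> /eqP E; rewrite -E in top *; apply/is_topP.
  by have := pcf m; rewrite mA.
move=> [/is_topP top pm]; exists [set d : contributor G | tails m == tails d].
apply/and3P; split; first by apply/activation_classP; exists m.
  apply/forallP => c; apply/implyP; rewrite inE => /eqP t.
  by rewrite -subset0 -(eqP pm) positive_circles_below ?top.
rewrite /maximal_in inE eqxx /=; apply/forallP => d; apply/implyP.
rewrite inE => /eqP t; apply/implyP => /act_leP[_ a].
by apply/eqP/contributor_eq => //; apply/eqP; rewrite eqEsubset a top.
Qed.

(** * Signs and the Leibniz expansion *)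

Lemma isgn_sqr (i : incidence G) : isgn i * isgn i = 1.
Proof. by have := isgnP i; rewrite !inE => /orP[] /eqP->. Qed.

Lemma circle_sign_cases c O : (circle_sign c O == 1) || (circle_sign c O == -1).
Proof.
rewrite -sqrf_eq1 circle_signE exprMn sqrr_sign mul1r -prodrXl.
by apply/eqP/big1 => v _; rewrite expr2 mulrACA !isgn_sqr mulr1.
Qed.

Lemma opp_walk_sign1 x :
  - walk_sign [:: x] = isgn (tail_inc x) * isgn (head_inc x).
Proof. by rewrite /walk_sign big_seq1 expr1 mulN1r opprK. Qed.

Lemma trivIset_circles c : trivIset (circles c).
Proof.
apply/trivIsetP => O1 O2 O1C O2C; apply: contraR => /pred0Pn[v /andP[/= v1 v2]].
by rewrite (circle_porbit _ _ _ O1C v1) (circle_porbit _ _ _ O2C v2).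
Qed.

(** Orbits are circles or single backsteps; this count yields the parity of [contributor_perm c]. *)
Lemma card_porbits c :
  #|porbits (contributor_perm c)| = (#|circles c| + #|~: active c|)%N.
Proof.
have -> : porbits (contributor_perm c) =
    circles c :|: [set [set v] | v in ~: active c].
  rewrite circlesE.
  have -> : [set [set v] | v in ~: active c] =
      porbit (contributor_perm c) @: (~: active c).
    by apply: eq_in_imset => v; rewrite in_setC => /porbit_inactive.
  rewrite -imsetU setUCr.
  by apply/setP => O; apply/imsetP/imsetP => -[v _ ->]; exists v.
rewrite cardsU card_imset; last exact: set1_inj.
suff -> : circles c :&: [set [set v] | v in ~: active c] = set0.
  by rewrite cards0 subn0.
apply/setP => O; rewrite in_setI in_set0; apply/negP => /andP[OC /imsetP[v va OE]].
move: va; rewrite in_setC (subsetP (circle_active _ _ OC)) //.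
by rewrite OE set11.
Qed.

(** Backsteps contribute a square, that is 1. Modulo 2 the permutation has parity
    [#|active c| + #|circles c|], which is the sum of [#|O|.+1] over the circles: [#|O|] from the
    walk sign and one from the negation. *)
Lemma contributor_weight c :
  (-1) ^+ contributor_perm c * \prod_v - walk_sign [:: c v]
    = \prod_(O in circles c) - circle_sign c O.
Proof.
pose s v : int := isgn (tail_inc (c v)) * isgn (head_inc (c v)).
have -> : \prod_v - walk_sign [:: c v] = \prod_(O in circles c) \prod_(v in O) s v.
  rewrite -big_trivIset ?trivIset_circles //= cover_circles.
  rewrite [RHS]big_mkcond /=; apply: eq_bigr => v _; rewrite opp_walk_sign1.
  by case: ifPn => //; rewrite inE negbK => /eqP <-; apply: isgn_sqr.
under [RHS]eq_bigr => O _ do rewrite circle_signE -mulNr -mulN1r -exprS.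
rewrite big_split /=; congr (_ * _).
rewrite prodrXr -[RHS]signr_odd; congr (_ ^+ (nat_of_bool _)).
have -> : (\sum_(O in circles c) #|O|.+1 = #|active c| + #|circles c|)%N.
  rewrite -cover_circles.
  have /eqP <- := trivIset_circles c.
  by rewrite -sum1_card -big_split /=; apply: eq_bigr => O _; rewrite addn1.
rewrite /odd_perm card_porbits -(cardsC (active c)).
rewrite !oddD; case: (odd #|active c|); case: (odd #|circles c|);
  by case: (odd #|~: active c|).
Qed.

Lemma det_laplacian : \det (laplacian G) =
  \sum_(c : contributor G) \prod_(O in circles c) - circle_sign c O.
Proof.
transitivity (\sum_(c : contributor G)
    (-1) ^+ contributor_perm c * \prod_v - walk_sign [:: c v] : int); last first.
  by apply: eq_bigr => c _; apply: contributor_weight.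
rewrite /determinant (reindex (perm_enum _)) /=; last first.
  by apply: onW_bij; apply: perm_enum_bij.
rewrite [RHS](partition_big (@contributor_perm G) predT) //=.
apply: eq_bigr => s _; rewrite (odd_perm_enum _ s) => [|v]; last exact: perm_enumE.
rewrite [RHS](eq_bigr (fun c : contributor G =>
  (-1) ^+ s * \prod_v - walk_sign [:: c v])) => [|c /eqP-> //].
rewrite -mulr_sumr; congr (_ * _).
rewrite (reindex (@enum_rank (vertex G))) /=; last first.
  by apply: onW_bij; apply: enum_rank_bij.
under eq_bigr => v _ do rewrite mxE perm_enumE !enum_rankK.
(* The product of entries becomes a sum over functions choosing a step from each [v] to [s v]. *)
rewrite bigA_distr_big_dep.
pose h c := precontributor_fun (contributor_val c).
have h_inj : injective h by move=> c d /val_inj/val_inj.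
pose C := [set c : contributor G | contributor_perm c == s].
rewrite [RHS](eq_bigl (mem C)) => [|c]; last by rewrite !inE.
rewrite -[RHS](@big_imset _ _ _ _ _ h C (fun f : {ffun vertex G -> ipmap G} =>
  \prod_v - walk_sign [:: f v])) /=; last by move=> c d _ _ /h_inj.
(* These functions are exactly the contributors with permutation [s]. *)
apply: eq_bigl => f; apply/familyP/imsetP => [fP|[c]]; last first.
  rewrite inE => /eqP cs -> v.
  apply/andP; rewrite -cs contributor_permE; split; apply/eqP => //.
  exact: tail_contributor.
have tf v : tail (f v) = v by have /andP[/eqP] := fP v.
have hf v : head (f v) = s v by have /andP[_ /eqP] := fP v.
have [//||c cE] := ex_contributor f; first by move=> v w; rewrite !hf => /perm_inj.
exists c; last by apply/ffunP => v; rewrite -cE.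
by rewrite inE; apply/eqP/permP => v; rewrite contributor_permE cE.
Qed.

(** * Summation over the activation classes *)

(** Expanding the right side gives one term per subset of [circles m], that is per contributor with
    the tails of [m]. *)
Lemma sum_circles_below m : is_top m ->
  \sum_(c : contributor G | tails c == tails m) \prod_(O in circles c) - circle_sign c O
    = \prod_(O in circles m) (1 - circle_sign m O).
Proof.
move=> /is_topP top.
pose F (S : {set {set vertex G}}) := \prod_(O in S) - circle_sign m O.
pose C := [set c : contributor G | tails c == tails m].
transitivity (\sum_(c in C) F (circles c)).
  rewrite (eq_bigl (fun c => c \in C)) => [|c]; last by rewrite inE.
  apply: eq_bigr => c; rewrite inE => /eqP t; apply: eq_bigr => O OC.
  have Oc := circle_active _ _ OC.
  by congr (- _); apply: circle_sign_eq => //; apply: subset_trans Oc (top _ t).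
rewrite [RHS]big_mkcond /=.
(* The default 0 gives factor 1 outside [circles m] and kills the subsets not contained in it. *)
transitivity (\prod_O ((if O \in circles m then - circle_sign m O else 0) + 1)).
  rewrite bigA_distr /=.
  rewrite [RHS](bigID (fun S : {set {set vertex G}} => S \subset circles m)) /=.
  rewrite [X in _ = _ + X]big1 ?addr0 => [|S /subsetPn[O OS OC]]; last first.
    by rewrite (bigD1 O) //= OS (negPf OC) mul0r.
  rewrite [RHS](eq_bigr F) => [|S /subsetP sS]; last first.
    rewrite /F [RHS]big_mkcond; apply: eq_bigr => O _.
    by case: ifP => // /sS->.
  rewrite -(big_imset F) /= => [|c d]; last first.
    by rewrite !inE => /eqP tc /eqP td; apply: tails_circles_inj; rewrite tc.
  apply: eq_bigl => S; apply/imsetP/idP => [[c]|/ex_subcircles[c [tc _ <-]]].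
    by rewrite inE => /eqP tc ->; rewrite circles_subset ?top.
  by exists c; rewrite ?inE ?tc.
by apply: eq_bigr => O _; case: ifP => _; rewrite ?add0r // addrC.
Qed.

Lemma prod_circle_signs m :
  \prod_(O in circles m) (1 - circle_sign m O) =
    if positive_circles m == set0 then 2 ^+ nc m else 0.
Proof.
case: eqP => [p0|/eqP/set0Pn[O /setIdP[OC /eqP pos]]]; last first.
  by rewrite (bigD1 O) //= pos subrr mul0r.
have neg O : O \in circles m -> circle_sign m O = -1.
  move=> OC; have /orP[pos|/eqP//] := circle_sign_cases m O.
  by have : O \in positive_circles m; [apply/setIdP|rewrite p0 inE].
rewrite (eq_bigr (fun=> 2)) => [|O /neg->]; last by rewrite opprK.
rewrite prodr_const; congr (_ ^+ _); apply: eq_card => O.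
by apply/idP/setIdP => [OC|[]] //; split=> //; apply/eqP/neg.
Qed.

(** Tops with equal tails have equal active sets; hence grouping by tops counts each contributor
    once. *)
Lemma card_top c :
  #|[set m | is_top m & tails c == tails m]| = 1%N.
Proof.
have [m [tm top]] := ex_top c.
have mt : is_top m by apply/is_topP => d; rewrite tm => /top.
apply/eqP/cards1P; exists m; apply/setP => m'; rewrite !inE.
apply/andP/eqP => [[/is_topP mt' /eqP t]|->]; last by rewrite tm.
apply: contributor_eq; first by rewrite -t tm.
by apply/eqP; rewrite eqEsubset top ?mt' // tm.
Qed.

End Contributors.

Theorem lemma4p3 (G : bidirected_graph) :
  \det (laplacian G) =
    \sum_(c in maximal_positive_circle_free G) (2 : int) ^+ nc c.
Proof.
pose w (c : contributor G) := \prod_(O in circles c) - circle_sign c O.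
transitivity (\sum_(m : contributor G | is_top G m) \sum_(c : contributor G | tails G c == tails G m) w c).
  rewrite det_laplacian (exchange_big_dep predT) //=; apply: eq_bigr => c _.
  rewrite sumr_const; have := card_top G c; rewrite cardsE.
  by rewrite (eq_card (B := [pred m : contributor G | is_top G m & tails G c == tails G m])) // => ->.
rewrite [RHS](eq_bigl _ _ (maximal_positive_circle_freeE G)).
(* Tops with a positive circle stay in the sum with value 0, matching [prod_circle_signs]. *)
rewrite big_mkcondr; apply: eq_bigr => m /sum_circles_below ->.
exact: prod_circle_signs.
Qed.
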